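(* Let $\Omega$ be a non-empty set and let $\underline{\Gamma}$ be a functional defined on a subset $\operatorname{dom}\underline{\Gamma}$ of the set $\mathcal{L}$ of all gambles on $\Omega$. The following holds. (i) If $\underline{\Gamma}$ is exact, then there is a coherent lower prevision $\underline{P}$ defined on $\operatorname{dom}\underline{\Gamma}$ such that $\underline{\Gamma}=\|\underline{\Gamma}\|\,\underline{P}$, and moreover $\underline{E}_{\underline{\Gamma}}=\|\underline{\Gamma}\|\,\underline{E}_{\underline{P}}$. (ii) $\underline{\Gamma}$ is exact if and only if there is a coherent lower prevision $\underline{P}$ defined on $\operatorname{dom}\underline{\Gamma}$ and a non-negative real number $\lambda$ such that $\underline{\Gamma}=\lambda\underline{P}$. In that case, $\lambda\underline{E}_{\underline{P}}$ is an exact extension of $\underline{\Gamma}$ with norm $\lambda$. If, additionally, the constant gamble $1$ belongs to $\operatorname{dom}\underline{\Gamma}$, then $\lambda$ is uniquely given by $\underline{\Gamma}(1)$, and hence $\underline{E}_{\underline{\Gamma}}=\underline{\Gamma}(1)\underline{E}_{\underline{P}}$; and if also $\underline{\Gamma}$ is non-zero for at least one gamble in its domain, then $\underline{\Gamma}(1)$ is non-zero as well, and hence $\underline{P}$ is uniquely given by $\underline{\Gamma}/\underline{\Gamma}(1)$.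
   Context: A gamble on $\Omega$ is a bounded real-valued map on $\Omega$; $\mathcal{L}$ carries pointwise operations and order; a real number $\mu$ also denotes the constant gamble $\mu$. A functional is a real-valued map defined on a subset of $\mathcal{L}$ (its domain, $\operatorname{dom}$); a lower prevision is also a real-valued map defined on a subset of $\mathcal{L}$. Coherence: a lower prevision $\underline{P}$ whose domain is a linear space is coherent if for all $f,g$ in the domain and real $\lambda\geq0$: $\underline{P}(f)\geq\inf f$; $\underline{P}(\lambda f)=\lambda\underline{P}(f)$; $\underline{P}(f+g)\geq\underline{P}(f)+\underline{P}(g)$. A lower prevision on an arbitrary subset of $\mathcal{L}$ is coherent if it can be extended to a coherent lower prevision on $\mathcal{L}$. The natural extension $\underline{E}_{\underline{P}}$ of a coherent lower prevision $\underline{P}$ is the pointwise smallest coherent lower prevision on $\mathcal{L}$ that dominates $\underline{P}$ on $\operatorname{dom}\underline{P}$; it is also given by $\underline{E}_{\underline{P}}(f)=\sup\{\sum_{k=1}^n\lambda_k\underline{P}(f_k)+\lambda: n\geq1,\lambda_k\geq0,\lambda\in\mathbb{R},f_k\in\operatorname{dom}\underline{P},\sum_{k=1}^n\lambda_kf_k+\lambda\leq f\}$. Exactness: a functional on $\mathcal{L}$ is exact if for all $f,g\in\mathcal{L}$, real $\lambda\geq0$ and real $\mu$: (E1) $f\geq g$ implies $\underline{\Gamma}(f)\geq\underline{\Gamma}(g)$; (E2) $\underline{\Gamma}(\lambda f)=\lambda\underline{\Gamma}(f)$; (E3) $\underline{\Gamma}(f+g)\geq\underline{\Gamma}(f)+\underline{\Gamma}(g)$;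 (E4) $\underline{\Gamma}(f+\mu)=\underline{\Gamma}(f)+\underline{\Gamma}(\mu)$. A functional on an arbitrary subset of $\mathcal{L}$ is exact if it can be extended to an exact functional on $\mathcal{L}$. Norm: $\|\underline{\Gamma}\|$ is the infimum of all $c\geq0$ such that for all $n\in\{1,2,\dots\}$, $\lambda_1,\dots,\lambda_n\geq0$, $\lambda\in\mathbb{R}$ and $f,f_1,\dots,f_n\in\operatorname{dom}\underline{\Gamma}$: $f\geq\sum_{k=1}^n\lambda_kf_k+\lambda$ implies $\underline{\Gamma}(f)\geq\sum_{k=1}^n\lambda_k\underline{\Gamma}(f_k)+\lambda c$. (Known results of Maaß: $\underline\Gamma$ is exact if and only if $\|\underline{\Gamma}\|<+\infty$; if $\underline{\Gamma}$ is exact and $1\in\operatorname{dom}\underline{\Gamma}$ then $\|\underline{\Gamma}\|=\underline{\Gamma}(1)$.) Natural extension of an exact functional $\underline{\Gamma}$: the functional on $\mathcal{L}$ given by $\underline{E}_{\underline{\Gamma}}(f)=\sup\{\sum_{k=1}^n\lambda_k\underline{\Gamma}(f_k)+\lambda\|\underline{\Gamma}\| : n\in\{1,2,\dots\},\lambda_k\geq0,\lambda\in\mathbb{R},f_k\in\operatorname{dom}\underline{\Gamma},\sum_{k=1}^n\lambda_kf_k+\lambda\leq f\}$. (Known result of Maaß: it is an exact extension of $\underline{\Gamma}$ with $\|\underline{E}_{\underline{\Gamma}}\|=\|\underline{\Gamma}\|=\underline{E}_{\underline{\Gamma}}(1)$.) *)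

(* Defs.v *)
From HB Require Import structures.
From mathcomp Require Import all_boot all_order all_algebra.
From mathcomp Require Import all_classical all_reals all_analysis.

Set Implicit Arguments.
Unset Strict Implicit.
Unset Printing Implicit Defensive.

Import Order.TTheory GRing.Theory Num.Theory.
Import numFieldNormedType.Exports.

Local Open Scope classical_set_scope.
Local Open Scope ring_scope.

Section Gambles.
Variables (R : realType) (Omega : Type).

Definition bounded_map : {pred Omega -> R} :=
  fun f => `[< bounded_fun f >].

Lemma bounded_mapP (f : Omega -> R) :
  reflect (exists M : R, forall w, `|f w| <= M) (f \in bounded_map).
Proof.
apply: (iffP idP) => [/asboolP[M [Mreal fM]]|[M fM]].
  by exists (M + 1) => w; apply: fM => //; rewrite ltrDl.
apply/asboolP; exists M; split; first exact: num_real.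
by move=> x Mx w _; exact: le_trans (fM w) (ltW Mx).
Qed.

Lemma bounded_map_submod_closed : submod_closed bounded_map.
Proof.
split=> [|a f g /bounded_mapP[M fM] /bounded_mapP[N gN]].
  by apply/bounded_mapP; exists 0 => w; rewrite normr0.
apply/bounded_mapP; exists (`|a| * M + N) => w.
rewrite (le_trans (ler_normD _ _))// lerD//.
by rewrite normrM ler_wpM2l.
Qed.

HB.instance Definition _ :=
  GRing.isSubmodClosed.Build R (Omega -> R) bounded_map
    bounded_map_submod_closed.

Record gamble := Gamble {
  gamble_fun :> Omega -> R;
  gamble_bounded : gamble_fun \in bounded_map }.

HB.instance Definition _ := [isSub for gamble_fun].
HB.instance Definition _ := [Choice of gamble by <:].
HB.instance Definition _ := [SubChoice_isSubLmodule of gamble by <:].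

Lemma cst_bounded (mu : R) : (fun=> mu) \in bounded_map.
Proof. by apply/bounded_mapP; exists `|mu|. Qed.

Definition cstg (mu : R) : gamble := Gamble (cst_bounded mu).

Lemma gambleDE (f g : gamble) w : (f + g) w = f w + g w.
Proof. by []. Qed.

Lemma gambleZE (a : R) (f : gamble) w : (a *: f) w = a * f w.
Proof. by []. Qed.

Definition gamble_le (f g : gamble) := forall w, f w <= g w.

(* A functional (or lower prevision) with domain D is represented by D together
   with a map on all gambles; its values outside D are never consulted. *)
Implicit Types (D : set gamble) (G P Q E : gamble -> R).

Definition extends D G E := forall f, D f -> E f = G f.

Record coherent_full Q : Prop := CoherentFull {
  coherent_inf : forall f : gamble, inf (range f) <= Q f;
  coherentZ : forall (lambda : R) f, 0 <= lambda ->
    Q (lambda *: f) = lambda * Q f;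
  coherentD : forall f g, Q f + Q g <= Q (f + g) }.

Definition coherent D P := exists2 Q, coherent_full Q & extends D P Q.

Record exact_full G : Prop := ExactFull {
  exact_mono : forall f g, gamble_le g f -> G g <= G f;
  exactZ : forall (lambda : R) f, 0 <= lambda ->
    G (lambda *: f) = lambda * G f;
  exactD : forall f g, G f + G g <= G (f + g);
  exact_cst : forall f (mu : R), G (f + cstg mu) = G f + G (cstg mu) }.

Definition exact D G := exists2 E, exact_full E & extends D G E.

Definition is_prev_natext D P E :=
  [/\ coherent_full E,
      forall f, D f -> P f <= E f &
      forall Q, coherent_full Q -> (forall f, D f -> P f <= Q f) ->
        forall f, E f <= Q f].

(* Definite description; the default 0 is only returned when no pointwise
   smallest dominating coherent lower prevision exists. *)
Definition prev_natext D P : gamble -> R :=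
  xget (fun=> 0) [set E | is_prev_natext D P E].

Lemma prev_natextE D P E : is_prev_natext D P E -> prev_natext D P = E.
Proof.
move=> EP; apply: xget_unique => // E' [coh' dom' least'].
case: EP => coh dom least; apply/funext => f; apply/le_anti.
by rewrite least'//= least.
Qed.

(* The infimum of the empty set of constants is +oo. *)
Definition fnorm D G : \bar R :=
  ereal_inf [set c%:E | c in [set c : R | 0 <= c /\
    forall (n : nat) (lam : 'I_n -> R) (lambda : R)
           (f : gamble) (fs : 'I_n -> gamble),
      (1 <= n)%N -> (forall k, 0 <= lam k) -> D f -> (forall k, D (fs k)) ->
      gamble_le (\sum_(k < n) lam k *: fs k + cstg lambda) f ->
      \sum_(k < n) lam k * G (fs k) + lambda * c <= G f]].

(* Intended for exact functionals, whose norm is finite. When D is empty the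
   supremum is over the empty set and is 0 by the convention of sup, so that
   the natural extension of the empty functional is the zero functional. *)
Definition exact_natext D G (f : gamble) : R :=
  sup [set x : R | exists (n : nat) (lam : 'I_n -> R) (lambda : R)
                          (fs : 'I_n -> gamble),
    [/\ (1 <= n)%N, forall k, 0 <= lam k, forall k, D (fs k),
        gamble_le (\sum_(k < n) lam k *: fs k + cstg lambda) f &
        x = \sum_(k < n) lam k * G (fs k) + lambda * fine (fnorm D G)]].

End Gambles.

(* Main.v *)
(* The infimum c defining the norm of an exact G is attained. If c = 0, then G
   vanishes on its domain and every coherent P will do. If c > 0, then P := G / c
   satisfies the norm inequalities with constant 1, and these say precisely that
   the supremum formula for the natural extension is finite and agrees with P on
   the domain; it then defines a coherent extension, which is the smallest one.
   Multiplying the supremum formula for P by c gives the one for G. Conversely,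
   a nonnegative multiple of a coherent lower prevision on all gambles is exact,
   because coherence forces Q (f + mu) = Q f + mu. *)

Require Import Defs.
From HB Require Import structures.
From mathcomp Require Import all_boot all_order all_algebra.
From mathcomp Require Import all_classical all_reals all_analysis.
From mathcomp Require Import lra.

Set Implicit Arguments.
Unset Strict Implicit.
Unset Printing Implicit Defensive.

Import Order.TTheory GRing.Theory Num.Theory.
Import numFieldNormedType.Exports.

Local Open Scope classical_set_scope.
Local Open Scope ring_scope.

(** * Nonnegative combinations of gambles in the domain *)

Section ConicCombinations.
Variables (R : realType) (Omega : Type).
Local Notation gamble := (gamble R Omega).
Implicit Types (D : set gamble) (G P Q E : gamble -> R) (f g h : gamble).

Lemma gamble_ext f g : (forall w, f w = g w) -> f = g.
Proof. by move=> fg; apply/val_inj/funext. Qed.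

(* The empty combination is allowed, unlike in [fnorm] and [exact_natext],
   where n >= 1; this makes no difference when D is nonempty. *)
Inductive conic D G : gamble -> R -> Prop :=
| conic0 : conic D G 0 0
| conic_cons (l : R) f h v : 0 <= l -> D f -> conic D G h v ->
    conic D G (l *: f + h) (l * G f + v).

Lemma conic_incl D G f : D f -> conic D G f (G f).
Proof.
move=> Df; have := conic_cons ler01 Df (conic0 D G).
by rewrite scale1r mul1r !addr0.
Qed.

Lemma conicD D G h h' v v' : conic D G h v -> conic D G h' v' ->
  conic D G (h + h') (v + v').
Proof.
move=> hv hv'; elim: hv => [|l f g u l0 Df _ IH]; first by rewrite !add0r.
by rewrite -!addrA; exact: conic_cons.
Qed.

Lemma conicZ D G (a : R) h v : 0 <= a -> conic D G h v ->
  conic D G (a *: h) (a * v).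
Proof.
move=> a0; elim=> [|l f g u l0 Df _ IH].
  by rewrite scaler0 mulr0; exact: conic0.
rewrite scalerDr scalerA mulrDr mulrA.
by apply: conic_cons => //; exact: mulr_ge0.
Qed.

Lemma conic_sum D G n (lam : 'I_n -> R) (fs : 'I_n -> gamble) :
  (forall k, 0 <= lam k) -> (forall k, D (fs k)) ->
  conic D G (\sum_(k < n) lam k *: fs k) (\sum_(k < n) lam k * G (fs k)).
Proof.
elim: n lam fs => [|n IH] lam fs lam0 Dfs.
  by rewrite !big_ord0; exact: conic0.
by rewrite !big_ord_recl; apply: conic_cons => //; exact: IH.
Qed.

Lemma conicP D G h v f0 : D f0 -> conic D G h v ->
  exists (n : nat) (lam : 'I_n -> R) (fs : 'I_n -> gamble),
    [/\ (1 <= n)%N, forall k, 0 <= lam k, forall k, D (fs k),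
        h = \sum_(k < n) lam k *: fs k & v = \sum_(k < n) lam k * G (fs k)].
Proof.
move=> Df0; elim=> [|l f g u l0 Df _ [n [lam [fs [_ lam0 Dfs -> ->]]]]].
  (* The empty combination becomes a single term with coefficient 0; [f0] is needed only here. *)
  exists 1%N, (fun=> 0), (fun=> f0); split=> //.
    by rewrite big_ord1 scale0r.
  by rewrite big_ord1 mul0r.
exists n.+1, (fun k => oapp lam l (unlift ord0 k)),
  (fun k => oapp fs f (unlift ord0 k)); split=> //.
- by move=> k; case: unliftP => [j|] _ /=.
- by move=> k; case: unliftP => [j|] _ /=.
- rewrite big_ord_recl unlift_none /=; congr (_ + _).
  by apply: eq_bigr => k _; rewrite liftK.
- rewrite big_ord_recl unlift_none /=; congr (_ + _).
  by apply: eq_bigr => k _; rewrite liftK.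
Qed.

Lemma conic_scale D G P (c : R) h v : (forall f, D f -> G f = c * P f) ->
  conic D P h v -> conic D G h (c * v).
Proof.
move=> GP; elim=> [|l f g u l0 Df _ IH]; first by rewrite mulr0; exact: conic0.
by rewrite mulrDr mulrCA -GP//; exact: conic_cons.
Qed.

Lemma conic_le D G E h v : (forall f, D f -> G f <= E f) ->
  (forall f g, E f + E g <= E (f + g)) ->
  (forall (l : R) f, 0 <= l -> E (l *: f) = l * E f) ->
  conic D G h v -> v <= E h.
Proof.
move=> GE ED EZ; elim=> [|l f g u l0 Df _ IH].
  by have := EZ 0 0 (lexx 0); rewrite scale0r mul0r => ->.
by apply: le_trans (ED _ _); rewrite lerD// EZ// ler_wpM2l// GE.
Qed.

(** * Admissible norm constants and their infimum *)

Definition norm_bound D G (c : R) := forall h v (l : R) f,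
  D f -> conic D G h v -> gamble_le (h + cstg Omega l) f -> v + l * c <= G f.

Lemma fnormE D G :
  fnorm D G = ereal_inf [set c%:E | c in [set c | 0 <= c /\ norm_bound D G c]].
Proof.
rewrite /fnorm; congr (ereal_inf (image _ _)); apply/seteqP.
split=> c /= [c0 Gc]; split=> //.
  move=> h v l f Df hv hf.
  have [n [lam [fs [n1 lam0 Dfs hE ->]]]] := conicP Df hv.
  by apply: Gc => //; rewrite -hE.
move=> n lam l f fs n1 lam0 Df Dfs hf.
by apply: Gc hf => //; exact: conic_sum.
Qed.

(** Each norm inequality is affine in [c]. For [l >= 0] it survives lowering [c]; for [l < 0],
    dividing by [l] turns it into a lower bound on [c], which passes to the infimum. *)
Lemma fnorm_attained D G : (exists2 c, 0 <= c & norm_bound D G c) ->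
  exists2 c, 0 <= c & norm_bound D G c /\ fnorm D G = c%:E.
Proof.
move=> [c0 c00 Gc0].
set A := [set c | 0 <= c /\ norm_bound D G c].
have A0 : A !=set0 by exists c0.
have Alb : has_lbound A by exists 0 => c [].
exists (inf A); first by apply: lb_le_inf => // c [].
split; last by rewrite fnormE ereal_inf_EFin.
move=> h v l f Df hv hf; have [l0|l0] := leP 0 l.
  apply: le_trans (Gc0 _ _ _ _ Df hv hf).
  by rewrite lerD2l ler_wpM2l// ge_inf.
rewrite -lerBrDl -ler_ndivrMl// mulrC.
apply: lb_le_inf => // c [_ Gc].
by rewrite mulrC ler_ndivrMl// lerBrDl; exact: Gc hf.
Qed.

(** Every norm inequality is vacuous here. Consequently a positive norm forces a nonempty domain. *)
Lemma fnorm_set0 G : fnorm set0 G = 0%:E.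
Proof.
rewrite fnormE; apply/le_anti/andP; split.
  by apply: ereal_inf_lbound; exists 0 => //; split=> // h v l f [].
by apply: le_ereal_inf_tmp => _ [c [c0 _] <-]; rewrite lee_fin.
Qed.

(** The two instances [0 + 1 <= 1] and [1 + 1 - 1 <= 1] of the norm inequality bound [c] from above
    and from below. *)
Lemma norm_bound_cst1 D G (c : R) : D (cstg Omega 1) -> norm_bound D G c ->
  c = G (cstg Omega 1).
Proof.
move=> D1 Gc; have G1 := conic_incl G D1.
apply/le_anti/andP; split.
  rewrite -(mul1r c) -[leLHS]add0r; apply: Gc (conic0 D G) _ => // w.
  by rewrite gambleDE add0r.
suff: G (cstg Omega 1) + G (cstg Omega 1) + -1 * c <= G (cstg Omega 1) by lra.
apply: Gc (conicD G1 G1) _ => // w.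
by rewrite !gambleDE /= -addrA subrr addr0.
Qed.

End ConicCombinations.

(** * Coherent and exact functionals on all gambles *)

Section CoherentAndExact.
Variables (R : realType) (Omega : Type).
Hypothesis Omega_neq0 : [set: Omega] !=set0.
Local Notation gamble := (gamble R Omega).
Local Notation cst1 := (cstg Omega (1 : R)).
Implicit Types (D : set gamble) (G P Q E : gamble -> R) (f g h : gamble).

Lemma inf_gamble_le f w : inf (range f) <= f w.
Proof.
have [M fM] := bounded_mapP _ (gamble_bounded f).
apply: ge_inf; last by exists w.
by exists (- M) => _ [x _ <-]; have := fM x; rewrite ler_norml => /andP[].
Qed.

Lemma le_inf_gamble f (a : R) : (forall w, a <= f w) -> a <= inf (range f).
Proof.
move=> af; apply: lb_le_inf => [|_ [w _ <-]//].
by have [w _] := Omega_neq0; exists (f w), w.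
Qed.

(** Superadditivity applies to [g = (g - f) + f], where [g - f] has nonnegative infimum. *)
Lemma coherent_full_mono Q f g : coherent_full Q -> gamble_le f g -> Q f <= Q g.
Proof.
case=> Qinf _ QD fg; rewrite -[g in leRHS](subrK f).
apply: le_trans (QD _ _); rewrite lerDr; apply: le_trans (Qinf _).
by apply: le_inf_gamble => w; have := fg w; rewrite -subr_ge0.
Qed.

(** The infimum bounds at [mu] and [- mu] are both tight, since superadditivity caps their sum by
    [Q 0 = 0]. *)
Lemma coherent_full_cst Q (mu : R) : coherent_full Q -> Q (cstg Omega mu) = mu.
Proof.
move=> [Qinf QZ QD].
have cstQ a : a <= Q (cstg Omega a).
  by apply: le_trans (Qinf _); exact: le_inf_gamble.
have Q0 : Q 0 = 0 by have := QZ 0 0 (lexx 0); rewrite scale0r mul0r.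
have := QD (cstg Omega mu) (cstg Omega (- mu)).
have -> : cstg Omega mu + cstg Omega (- mu) = 0.
  by apply: gamble_ext => w; rewrite gambleDE /= subrr.
by have := cstQ mu; have := cstQ (- mu); lra.
Qed.

Lemma coherent_full_translation Q f (mu : R) : coherent_full Q ->
  Q (f + cstg Omega mu) = Q f + mu.
Proof.
move=> cohQ; have QD := coherentD cohQ.
have := QD f (cstg Omega mu).
have := QD (f + cstg Omega mu) (cstg Omega (- mu)).
have -> : f + cstg Omega mu + cstg Omega (- mu) = f.
  by apply: gamble_ext => w; rewrite !gambleDE /= addrK.
by rewrite !coherent_full_cst//; lra.
Qed.

Lemma coherent_full_exact Q (c : R) : 0 <= c -> coherent_full Q ->
  exact_full (fun f => c * Q f).
Proof.
move=> c0 cohQ; split=> [f g gf|l f l0|f g|f mu].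
- by rewrite ler_wpM2l// coherent_full_mono.
- by rewrite (coherentZ cohQ)// mulrCA.
- by rewrite -mulrDr ler_wpM2l// (coherentD cohQ).
- by rewrite coherent_full_translation// coherent_full_cst// mulrDr.
Qed.

Lemma eval_coherent_full (w : Omega) : coherent_full (fun f => f w).
Proof. by split=> // f; exact: inf_gamble_le. Qed.

(** Homogeneity covers [mu >= 0]; a negative constant is reached by translating [- mu] to 0. *)
Lemma exact_full_cst E (mu : R) : exact_full E ->
  E (cstg Omega mu) = mu * E cst1.
Proof.
move=> [_ EZ _ EC].
have E0 : E 0 = 0 by have := EZ 0 0 (lexx 0); rewrite scale0r mul0r.
have Epos a : 0 <= a -> E (cstg Omega a) = a * E cst1.
  move=> a0; rewrite -EZ//; congr (E _).
  by apply: gamble_ext => w; rewrite gambleZE /= mulr1.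
have [mu0|mu0] := leP 0 mu; first exact: Epos.
have := EC (cstg Omega (- mu)) mu.
have -> : cstg Omega (- mu) + cstg Omega mu = 0.
  by apply: gamble_ext => w; rewrite gambleDE /= addNr.
by rewrite E0 Epos ?oppr_ge0 ?ltW//; lra.
Qed.

(** This yields the finiteness of the norm of an exact functional: any exact extension supplies an
    admissible constant. *)
Lemma exact_norm_bound D G E : exact_full E -> extends D G E ->
  norm_bound D G (E cst1).
Proof.
move=> exE EG h v l f Df hv hf; rewrite -(EG _ Df).
apply: le_trans (exact_mono exE hf); rewrite (exact_cst exE) (exact_full_cst l exE).
rewrite lerD2r; apply: conic_le hv; last exact: (exactZ exE).
  by move=> g Dg; rewrite EG.
exact: (exactD exE).
Qed.

Lemma exact_full_cst1_ge0 E : exact_full E -> 0 <= E cst1.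
Proof.
move=> exE; have := exact_full_cst 0 exE; rewrite mul0r => <-.
by apply: (exact_mono exE) => w.
Qed.

Lemma exact_fnorm D G : exact D G ->
  exists2 c, 0 <= c & norm_bound D G c /\ fnorm D G = c%:E.
Proof.
move=> [E exE EG]; apply: fnorm_attained.
by exists (E cst1); [exact: exact_full_cst1_ge0 | exact: exact_norm_bound].
Qed.

Lemma exact_fnorm_cst1 D G : exact D G -> D cst1 -> fnorm D G = (G cst1)%:E.
Proof.
by move=> /exact_fnorm[c _ [Gc ->]] D1; rewrite (norm_bound_cst1 D1 Gc).
Qed.

(** * The supremum formula for the natural extension of a lower prevision *)

Definition lower_values D P f : set R :=
  [set x | exists h v l,
    [/\ conic D P h v, gamble_le (h + cstg Omega l) f & x = v + l]].

Lemma lower_values_le D P Q f x : coherent_full Q ->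
  (forall g, D g -> P g <= Q g) -> lower_values D P f x -> x <= Q f.
Proof.
move=> cohQ PQ [h [v [l [hv hf ->]]]].
apply: le_trans (coherent_full_mono cohQ hf).
rewrite coherent_full_translation// lerD2r.
by apply: conic_le hv => //; [exact: coherentD|exact: coherentZ].
Qed.

(** The empty combination qualifies, so the set is nonempty even when [D] is empty. *)
Lemma lower_values_inf D P f : lower_values D P f (inf (range f)).
Proof.
exists 0, 0, (inf (range f)); split; rewrite ?add0r//; first exact: conic0.
exact: inf_gamble_le.
Qed.

Lemma lower_valuesD D P f g x y : lower_values D P f x ->
  lower_values D P g y -> lower_values D P (f + g) (x + y).
Proof.
move=> [h [v [l [hv hf ->]]]] [h' [v' [l' [hv' hg ->]]]].
exists (h + h'), (v + v'), (l + l'); split; first exact: conicD.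
  move=> w; have := hf w; have := hg w; rewrite !gambleDE /=; lra.
by rewrite addrACA.
Qed.

Lemma lower_valuesZ D P f (a : R) x : 0 <= a -> lower_values D P f x ->
  lower_values D P (a *: f) (a * x).
Proof.
move=> a0 [h [v [l [hv hf ->]]]].
exists (a *: h), (a * v), (a * l); split; first exact: conicZ.
  move=> w; have := hf w; rewrite !gambleDE !gambleZE /= -mulrDr => hfw.
  by rewrite ler_wpM2l.
by rewrite mulrDr.
Qed.

Lemma lower_values_incl D P f : D f -> lower_values D P f (P f).
Proof.
move=> Df; exists f, (P f), 0; split; first exact: conic_incl.
  by move=> w; rewrite gambleDE /= addr0.
by rewrite addr0.
Qed.

Section SupOfLowerValues.
Variables (D : set gamble) (P : gamble -> R).
Hypothesis bounded_lower_values :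
  forall f, has_ubound (lower_values D P f).

Local Notation S := (fun f => sup (lower_values D P f)).

Let S_ge f x : lower_values D P f x -> x <= S f.
Proof. exact: ub_le_sup. Qed.

Let S_le f (y : R) : (forall x, lower_values D P f x -> x <= y) -> S f <= y.
Proof.
by apply: ge_sup; exists (inf (range f)); exact: lower_values_inf.
Qed.

Lemma sup_lower_values_is_natext : is_prev_natext D P S.
Proof.
have SD f g : S f + S g <= S (f + g).
  rewrite -lerBrDr; apply: S_le => x fx.
  rewrite lerBrDl -lerBrDr; apply: S_le => y gy.
  by rewrite lerBrDr addrC; apply: S_ge; exact: lower_valuesD.
have SZ_ge (a : R) f : 0 < a -> a * S f <= S (a *: f).
  move=> a0; rewrite -ler_pdivlMl//; apply: S_le => x fx.
  by rewrite ler_pdivlMl//; apply/S_ge/lower_valuesZ => //; exact: ltW.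
split.
- split=> [f|a f|//]; first exact/S_ge/lower_values_inf.
  rewrite le_eqVlt => /predU1P[<-|a0].
    rewrite scale0r mul0r; apply/le_anti/andP; split.
      (* Superadditivity at 0 gives [S 0 + S 0 <= S 0], hence [S 0 <= 0]. *)
      by have := SD 0 0; rewrite addr0; lra.
    apply: S_ge; exists 0, 0, 0; split; rewrite ?addr0//; first exact: conic0.
    by move=> w; rewrite gambleDE add0r.
  apply/le_anti/andP; split; last exact: SZ_ge.
  (* The reverse inequality is [SZ_ge] for the factor [a^-1] at the gamble [a *: f]. *)
  rewrite -ler_pdivrMl//.
  have := SZ_ge a^-1 (a *: f); rewrite invr_gt0 scalerA mulVf ?gt_eqF//.
  by rewrite scale1r; exact.
- by move=> f Df; exact/S_ge/lower_values_incl.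
- by move=> Q cohQ PQ f; apply: S_le => x; exact: lower_values_le.
Qed.

End SupOfLowerValues.

Lemma coherent_has_ubound D P f : coherent D P ->
  has_ubound (lower_values D P f).
Proof.
move=> [Q cohQ QP]; exists (Q f) => x; apply: lower_values_le => // g Dg.
by rewrite QP.
Qed.

Lemma coherent_natextE D P : coherent D P ->
  prev_natext D P = (fun f => sup (lower_values D P f)).
Proof.
move=> cohP; apply: prev_natextE; apply: sup_lower_values_is_natext => f.
exact: coherent_has_ubound.
Qed.

Lemma coherent_natextP D P : coherent D P ->
  coherent_full (prev_natext D P) /\ extends D P (prev_natext D P).
Proof.
move=> cohP; rewrite coherent_natextE//.
have [|cohS PS least] := @sup_lower_values_is_natext D P.
  by move=> f; exact: coherent_has_ubound.
split=> // f Df; apply/le_anti; rewrite PS// andbT.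
have [Q cohQ QP] := cohP; rewrite -QP//.
by apply: least => // g Dg; rewrite QP.
Qed.

Lemma norm_bound1_coherent D P : D !=set0 -> norm_bound D P 1 -> coherent D P.
Proof.
move=> [f0 Df0] P1.
have ubP f : has_ubound (lower_values D P f).
  exists (- inf (range (- f))) => x [h [v [l [hv hf ->]]]].
  (* Absorbing [h + l <= sup f] into [f0 + h + l - sup f <= f0] turns the norm
     inequality at [f0] into an upper bound that does not involve [f0]. *)
  have := @P1 (f0 + h) (P f0 + v) (l + inf (range (- f))) f0 Df0
    (conicD (conic_incl P Df0) hv).
  rewrite mulr1; suff le_f0 : gamble_le
    (f0 + h + cstg Omega (l + inf (range (- f)))) f0 by move=> /(_ le_f0); lra.
  move=> w; have := hf w; rewrite !gambleDE /=.
  have : inf (range (- f)) <= - f w by exact: inf_gamble_le.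
  by lra.
have [cohS PS _] := sup_lower_values_is_natext ubP.
exists (fun f => sup (lower_values D P f)) => // f Df; apply/le_anti.
rewrite PS// andbT; apply: ge_sup.
  by exists (P f); exact: lower_values_incl.
(* For [f] in [D], the norm inequality with constant 1 says that no lower value exceeds [P f]. *)
by move=> x [h [v [l [hv hf ->]]]]; rewrite -[l]mulr1; exact: P1 hf.
Qed.

(** * Passing between [G] and [P] by rescaling *)

Lemma exact_natext_scale D G P (c : R) : coherent D P -> 0 <= c ->
  (forall f, D f -> G f = c * P f) -> fnorm D G = c%:E ->
  forall f, exact_natext D G f = c * prev_natext D P f.
Proof.
rewrite le_eqVlt => cohP /predU1P[<-|c0] GP normG f.
  (* For [c = 0] all values in the formula vanish; if [D] is empty there are none, and the default
     [sup set0 = 0] gives the same result. *)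
  rewrite mul0r /exact_natext normG /=; set A := [set x | _].
  suff /subset_set1[->|->] : A `<=` [set 0] by rewrite ?sup0 ?sup1.
  move=> _ [n [lam [l [fs [_ _ Dfs _ ->]]]]] /=.
  by rewrite mulr0 addr0 big1// => k _; rewrite GP// mul0r mulr0.
have cN0 : c != 0 by rewrite gt_eqF.
have PG g : D g -> P g = c^-1 * G g by move=> Dg; rewrite GP// mulKf.
have [f0 Df0] : D !=set0.
  apply: contrapT => /nonemptyPn D0; move: normG.
  by rewrite D0 fnorm_set0 => -[c0']; rewrite -c0' ltxx in c0.
rewrite coherent_natextE// /exact_natext normG /=; set A := [set x | _].
(* [AP] and [PA] together show that multiplication by [c] maps the lower values of [P] onto [A]. *)
have AP x : A x -> lower_values D P f (c^-1 * x).
  move=> [n [lam [l [fs [_ lam0 Dfs hf ->]]]]].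
  rewrite mulrDr mulrCA mulVf// mulr1.
  do 3 eexists; split; [|exact: hf|reflexivity].
  by apply: conic_scale PG _; exact: conic_sum.
have PA x : lower_values D P f x -> A (c * x).
  move=> [h [v [l [hv hf ->]]]].
  have [n [lam [fs [n1 lam0 Dfs hE vE]]]] := conicP Df0 (conic_scale GP hv).
  by exists n, lam, l, fs; split; rewrite -?hE// mulrDr vE mulrC.
have infP := lower_values_inf D P f.
apply/le_anti/andP; split.
  apply: ge_sup; first by exists (c * inf (range f)); exact: PA.
  move=> x /AP Px; rewrite -ler_pdivrMl//; apply: ub_le_sup Px.
  exact: coherent_has_ubound.
rewrite -ler_pdivlMl//; apply: ge_sup; first by exists (inf (range f)).
move=> x Px; rewrite ler_pdivlMl//; apply: ub_le_sup; last exact: PA.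
have [y Py] := coherent_has_ubound f cohP; exists (c * y) => z /AP /Py.
by rewrite ler_pdivrMl.
Qed.

Lemma exact_coherent D G : exact D G -> exists P c,
  [/\ coherent D P, 0 <= c, forall f, D f -> G f = c * P f &
      fnorm D G = c%:E].
Proof.
move=> /exact_fnorm[c]; rewrite le_eqVlt => /predU1P[<-|c0] [Gc normG].
  (* With norm 0, any coherent [P] serves; evaluation at a point is one. *)
  have [w _] := Omega_neq0; exists (fun f => f w), 0; split=> //.
    by exists (fun f => f w) => //; exact: eval_coherent_full.
  (* With norm 0, a large constant may be subtracted for free, so
     G f >= a G f for every a >= 0. *)
  move=> f Df; rewrite mul0r.
  have Gge (a : R) : 0 <= a -> a * G f <= G f.
    move=> a0; pose l := inf (range (f - a *: f)).
    have := Gc _ _ l _ Df (conicZ a0 (conic_incl G Df)).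
    rewrite mulr0 addr0; apply=> x; rewrite gambleDE gambleZE /=.
    have : l <= f x - a * f x by exact: inf_gamble_le.
    by rewrite /=; lra.
  (* The factor 2 forces [G f <= 0], the factor 0 forces [0 <= G f]. *)
  apply/le_anti/andP; split; first by have := Gge 2 (ler0n _ _); lra.
  by have := Gge 0 (lexx 0); rewrite mul0r.
exists (fun f => c^-1 * G f), c; split=> //; first last.
- by move=> f _; rewrite mulVKf// gt_eqF.
- exact: ltW.
apply: norm_bound1_coherent.
  apply/set0P/eqP => D0; move: normG.
  by rewrite D0 fnorm_set0 => -[c0']; rewrite -c0' ltxx in c0.
move=> h v l f Df hv hf; rewrite ler_pdivlMl// mulrDr mulr1 (mulrC c l).
apply: Gc hf => //; apply: conic_scale hv => g _.
by rewrite mulVKf// gt_eqF.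
Qed.

End CoherentAndExact.

Theorem theorem2 (R : realType) (Omega : Type)
    (Omega_neq0 : [set: Omega] !=set0)
    (D : set (gamble R Omega)) (G : gamble R Omega -> R) :
  (exact D G ->
     exists P : gamble R Omega -> R,
       [/\ coherent D P,
           (forall f, D f -> (G f)%:E = (fnorm D G * (P f)%:E)%E) &
           (forall f,
              (exact_natext D G f)%:E = (fnorm D G * (prev_natext D P f)%:E)%E)])
  /\ (exact D G <->
        exists (P : gamble R Omega -> R) (lambda : R),
          [/\ coherent D P, 0 <= lambda & forall f, D f -> G f = lambda * P f])
  /\ (forall (P : gamble R Omega -> R) (lambda : R),
        coherent D P -> 0 <= lambda ->
        (forall f, D f -> G f = lambda * P f) ->
        [/\ exact_full (fun f => lambda * prev_natext D P f),
            extends D G (fun f => lambda * prev_natext D P f),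
            fnorm setT (fun f => lambda * prev_natext D P f) = lambda%:E &
            D (cstg Omega 1) ->
              [/\ lambda = G (cstg Omega 1),
                  (forall f,
                     exact_natext D G f
                       = G (cstg Omega 1) * prev_natext D P f) &
                  (exists2 f, D f & G f != 0) ->
                    G (cstg Omega 1) != 0 /\
                    (forall f, D f -> P f = G f / G (cstg Omega 1))]]).
Proof.
have scale_exact P (c : R) : coherent D P -> 0 <= c ->
    (forall f, D f -> G f = c * P f) ->
    exact_full (fun f => c * prev_natext D P f) /\
    extends D G (fun f => c * prev_natext D P f).
  move=> cohP c0 GP; have [cohE EP] := coherent_natextP Omega_neq0 cohP.
  split; first exact: coherent_full_exact.
  by move=> f Df; rewrite EP// GP.
split; [|split; [split|]].
- move=> /exact_coherent[//|P [c [cohP c0 GP normG]]]; exists P; split=> // f.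
    by move=> Df; rewrite normG GP.
  by rewrite normG (exact_natext_scale _ _ c0 GP).
- by move=> /exact_coherent[//|P [c [cohP c0 GP _]]]; exists P, c.
- move=> [P [c [cohP c0 GP]]]; have [exE EG] := scale_exact _ _ cohP c0 GP.
  by exists (fun f => c * prev_natext D P f).
move=> P c cohP c0 GP; have [exE EG] := scale_exact _ _ cohP c0 GP.
have [cohE EP] := coherent_natextP Omega_neq0 cohP.
split=> // [|D1].
  (* On all gambles the norm is the value at 1, and the coherent natural extension takes the value 1
     there. *)
  rewrite exact_fnorm_cst1//; last by exists (fun f => c * prev_natext D P f).
  by rewrite coherent_full_cst// mulr1.
have exG : exact D G by exists (fun f => c * prev_natext D P f).
have cE : c = G (cstg Omega 1).
  by rewrite -EG// coherent_full_cst// mulr1.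
split=> //.
  move=> f; rewrite -cE; apply: exact_natext_scale => //.
  by rewrite cE; exact: exact_fnorm_cst1.
rewrite -cE => -[f Df Gf0].
(* A zero factor would make [G] vanish on all of [D]. *)
have cN0 : c != 0 by apply: contraNneq Gf0 => c00; rewrite GP// c00 mul0r.
by split=> // g Dg; rewrite GP// mulrC mulKf.
Qed.
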